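(* Let $\kappa$ be a singular (uncountable) cardinal with $2^{<\kappa}=\kappa$, and let $X$ be a nonempty regular Hausdorff space of weight at most $\kappa$. Then the $\kappa$-Borel hierarchy on $X$ collapses if and only if the $\kappa^+$-Borel hierarchy on $X$ collapses; that is, $\operatorname{ord}_\kappa(X)<\kappa^+$ if and only if $\operatorname{ord}_{\kappa^+}(X)<\kappa^+$. In particular, the $\kappa$-Borel hierarchy does not collapse on ${}^{\kappa}2$ and on all other such spaces $X$ for which there is a $\kappa^+$-Borel embedding of ${}^{\kappa}2$ into $X$.
   Context: For a topological space $X$ and an ordinal $\gamma>\omega$, define by recursion on ordinals $\alpha\ge 1$: $\gamma\text{-}\boldsymbol{\Sigma}^0_1(X)$ is the family of open sets; for $\alpha>1$, $\gamma\text{-}\boldsymbol{\Sigma}^0_\alpha(X)$ is the family of all unions $\bigcup_{\xi<\delta}A_\xi$ with $\delta<\gamma$ and each $A_\xi\in\bigcup_{1\le\beta<\alpha}\gamma\text{-}\boldsymbol{\Pi}^0_\beta(X)$; $\gamma\text{-}\boldsymbol{\Pi}^0_\alpha(X)$ is the family of complements of sets in $\gamma\text{-}\boldsymbol{\Sigma}^0_\alpha(X)$. $\gamma\text{-}\mathbf{Bor}(X)$ is the smallest family of subsets of $X$ containing the open sets and closed under complements and well-ordered unions of length less than $\gamma$. The order is $\operatorname{ord}_\gamma(X)=\min\{\alpha\in\mathrm{Ord}\mid\gamma\text{-}\boldsymbol{\Sigma}^0_\alpha(X)=\gamma\text{-}\mathbf{Bor}(X)\}$. The $\gamma$-Borel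 hierarchy on $X$ collapses if $\operatorname{ord}_\gamma(X)<\gamma^*$, where $\gamma^*$ is the least regular cardinal $\ge\gamma$; for $\gamma=\kappa$ singular and for $\gamma=\kappa^+$ one has $\gamma^*=\kappa^+$. The space ${}^{\kappa}2$ carries the bounded topology, generated by the sets $[s]=\{x\in{}^{\kappa}2\mid s\subseteq x\}$ for $s\in{}^{<\kappa}2$. A $\kappa^+$-Borel embedding is an injective function $f\colon Y\to Z$ such that preimages of open sets under both $f\colon Y\to f[Y]$ and $f^{-1}\colon f[Y]\to Y$ are $\kappa^+$-Borel, where $f[Y]$ has the subspace topology. *)

(* Defs.v *)
From HB Require Import structures.
From mathcomp Require Import all_boot all_classical wochoice topology.

Set Implicit Arguments.
Unset Strict Implicit.
Unset Printing Implicit Defensive.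

Local Open Scope classical_set_scope.
Local Open Scope card_scope.

(* Ordinals are represented by well-ordered types, compared through order
   isomorphisms onto initial segments. [ole] is the non-strict order;
   [well_order ole] makes it a linear order. *)
Record Ord := MkOrd {
  carrier :> Type;
  ole : rel carrier;
  ole_wo : well_order ole
}.

Definition olt (a : Ord) (x y : a) : bool := ~~ ole y x.

Definition oembed (a b : Ord) (f : a -> b) :=
  forall x y, ole (f x) (f y) = ole x y.

Definition ord_iso (a b : Ord) := exists2 f : a -> b, oembed f & bijective f.

Definition ord_lt (a b : Ord) :=
  exists f : a -> b, exists y : b, oembed f /\ range f = [set z | olt z y].

Definition ord_le (a b : Ord) := ord_lt a b \/ ord_iso a b.

Lemma ord1_wo : well_order (fun _ _ : unit => true).
Proof. by move=> A [[] A0]; exists tt; split=> [|[] ?]; first split. Qed.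

Definition ord1 : Ord := MkOrd ord1_wo.

(* Cardinals are initial ordinals. *)

Definition is_cardinal (k : Ord) :=
  forall a : Ord, ord_lt a k -> [set: a] #!= [set: k].

Definition cofinal_map (d k : Ord) (f : d -> k) :=
  forall y : k, exists x : d, ole y (f x).

Definition is_cof (k d : Ord) :=
  (exists f : d -> k, cofinal_map f) /\
  forall e : Ord, (exists f : e -> k, cofinal_map f) -> ord_le d e.

Definition regular_cardinal (k : Ord) :=
  [/\ is_cardinal k, infinite_set [set: k] & is_cof k k].

Definition singular_cardinal (k : Ord) :=
  [/\ is_cardinal k, ~ countable [set: k] &
      exists2 d : Ord, is_cof k d & ord_lt d k].

Definition is_succ_cardinal (k kp : Ord) :=
  [/\ is_cardinal kp, ord_lt k kp &
      forall l : Ord, is_cardinal l -> ord_lt k l -> ord_le kp l].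

(* gs is the least regular cardinal above or equal to g. *)
Definition is_star (g gs : Ord) :=
  [/\ regular_cardinal gs, ord_le g gs &
      forall l : Ord, regular_cardinal l -> ord_le g l -> ord_le gs l].

(* Binary sequences of length < k: the length is the order type of the
   initial segment of k below [tag s]. *)
Definition binseq (k : Ord) : Type := {a : k & {x : k | olt x a} -> bool}.

(* 2^{<k} = k *)
Definition two_lt_eq (k : Ord) := [set: binseq k] #= [set: k].

(* The space ^k 2; a new name, so that the bounded topology is not confused
   with the product topology. *)
Definition cantor_space (k : Ord) : Type := k -> bool.

Definition cone (k : Ord) (s : binseq k) : set (cantor_space k) :=
  [set x | forall i : {i : k | olt i (tag s)}, x (sval i) = tagged s i].

HB.instance Definition _ (k : Ord) := gen_eqMixin (cantor_space k).
HB.instance Definition _ (k : Ord) := gen_choiceMixin (cantor_space k).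
HB.instance Definition _ (k : Ord) :=
  isSubBaseTopological.Build (cantor_space k) (range (@cone k)) id.

Section borel_hierarchy.
Variables (g : Ord) (X : topologicalType).

(* Recursion on a: the members of a family in a Pi class below a are written
   as complements of members B xi of the corresponding Sigma class. *)
Inductive gSigma : Ord -> set (set X) :=
| gSigma_open (a : Ord) (A : set X) : ord_iso a ord1 -> open A -> gSigma a A
| gSigma_bigcup (a d : Ord) (B : d -> set X) (b : d -> Ord) :
    ord_lt ord1 a -> ord_lt d g ->
    (forall xi, [/\ ord_le ord1 (b xi), ord_lt (b xi) a &
                    gSigma (b xi) (B xi)]) ->
    gSigma a (\bigcup_xi ~` B xi).

Definition gPi (a : Ord) : set (set X) := [set ~` A | A in gSigma a].

Definition gBor_closed (F : set (set X)) :=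
  (forall A, F A -> F (~` A)) /\
  (forall (d : Ord) (A : d -> set X),
     ord_lt d g -> (forall xi, F (A xi)) -> F (\bigcup_xi A xi)).

Definition gBor : set (set X) := smallest gBor_closed open.

Definition is_borel_order (a : Ord) :=
  [/\ ord_le ord1 a, gSigma a = gBor &
      forall b : Ord, ord_le ord1 b -> gSigma b = gBor -> ord_le a b].

(* ord_g(X) < d *)
Definition borel_order_lt (d : Ord) :=
  exists2 a : Ord, is_borel_order a & ord_lt a d.

Definition collapses := exists2 gs : Ord, is_star g gs & borel_order_lt gs.

End borel_hierarchy.

Lemma ord_iso1_lt (a : Ord) : ord_iso a ord1 -> ~ ord_lt ord1 a.
Proof.
move=> [f fe [h hf _]] [e [y [ee /seteqP[/(_ (e tt)) + _]]]].
have -> : y = e tt by rewrite -(hf y) -(hf (e tt)); case: (f y); case: (f _).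
by move=> /(_ (imageT _ _)) /=; rewrite /olt -fe.
Qed.

(* The defining clauses of the recursion. *)
Lemma gSigma1E (g : Ord) (X : topologicalType) (a : Ord) :
  ord_iso a ord1 -> gSigma g a = @open X.
Proof.
move=> a1; apply/seteqP; split=> [A SA|A oA]; last exact: gSigma_open.
case: SA a1 => // {a A} a d B b lt1a _ _ a1.
by case: (ord_iso1_lt a1 lt1a).
Qed.

Lemma gSigma_gt1E (g : Ord) (X : topologicalType) (a : Ord) :
  ord_lt ord1 a ->
  gSigma g a = [set U : set X | exists d : Ord, ord_lt d g /\
    exists2 A : d -> set X, U = \bigcup_xi A xi &
      forall xi, exists b : Ord,
        [/\ ord_le ord1 b, ord_lt b a & gPi g b (A xi)]].
Proof.
move=> lt1a; apply/seteqP; split=> U.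
  move=> SU; case: SU lt1a => {a U} [a A a1 _ /(ord_iso1_lt a1)//|].
  move=> a d B b _ dg H lt1a; exists d; split=> //.
  exists (fun xi => ~` B xi) => // xi; have [? ? ?] := H xi.
  by exists (b xi); split=> //; exists (B xi).
move=> [d [dg [A -> H]]].
have [b bP] := choice H.
have /choice[B BP] : forall xi, exists B : set X,
    gSigma g (b xi) B /\ ~` B = A xi.
  by move=> xi; have [_ _ [B SB <-]] := bP xi; exists B.
have -> : A = (fun xi => ~` B xi) by apply/funext => xi; have [] := BP xi.
apply: (@gSigma_bigcup g X a d B b) => // xi.
by have [? ? _] := bP xi; have [? _] := BP xi; split.
Qed.

Definition corestr (Y Z : Type) (f : Y -> Z) (y : Y) : range f :=
  exist _ (f y) (mem_set (imageT f y)).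

(* [range f] carries the subspace topology; h is the inverse of Y -> f[Y]. *)
Definition borel_embedding (g : Ord) (Y Z : topologicalType) (f : Y -> Z) :=
  [/\ injective f,
      forall V : set (range f), open V -> gBor g (corestr f @^-1` V) &
      exists h : range f -> Y,
        [/\ cancel (corestr f) h, cancel h (corestr f) &
            forall U : set Y, open U -> gBor g (h @^-1` U)]].

Definition weight_le (X : topologicalType) (k : Ord) :=
  exists2 B : set (set X), basis B & B #<= [set: k].

(* Main.v *)
From mathcomp Require Import all_boot finmap all_classical wochoice topology.
Require Import Defs.

Set Implicit Arguments.
Unset Strict Implicit.
Unset Printing Implicit Defensive.

Local Open Scope classical_set_scope.
Local Open Scope card_scope.

(** Write k^+ for the successor of the singular cardinal k.

    The two hierarchies collapse together. Since k is singular, a union of k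
    sets is a union, over the cofinality of k, of unions of fewer than k sets;
    hence k-Borel and k^+-Borel sets coincide ([gBor_succ]). Every stage of the
    k-hierarchy is contained in the same stage of the k^+-hierarchy
    ([gSigma_mono]). Conversely the same splitting shows by induction that
    every stage below k^+ of the k^+-hierarchy is contained in the union of the
    stages below some w < k^+ of the k-hierarchy ([bounded_gSigma_succ]):
    regularity of k^+ bounds the stages needed for the at most k many earlier
    classes, and three further stages then suffice. So if either
    hierarchy exhausts the Borel sets before k^+, so does the other. Both orders
    are compared with k^+ because k^+ is the least regular cardinal above k
    ([star_singular]).

    The hierarchy does not collapse in the presence of ^k 2. Let f embed ^k 2
    into X, which has a base of size at most k. For each a < k^+ the sets of
    class Sigma_a in X are parametrized by points of ^k 2: a point x is
    decoded into indices of basic open sets, or into k codes of sets of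
    earlier classes, in such a way that membership of f x in the set coded by
    x is a k^+-Borel condition on x ([universal_gSigma]). The set of x for
    which this fails is Borel, so by the embedding it is the preimage of a
    Borel set S of X; if S were of class Sigma_a it would have a code y, and f
    y would belong to S exactly when it does not ([diagonal]). For X = ^k 2
    take the identity; its cones form a base of size 2^<k = k ([open_cone]).

    The set theory behind this is comparability of well-orders
    ([ord_le_or_gt]), the inequality k * k <= k, read off 2^<k = k
    ([two_lt_eq_square]), and the resulting regularity of k^+
    ([succ_bound]). *)

(** * Well-ordered types *)

Section ord_order.
Variable a : Ord.
Implicit Types x y z : a.

Lemma ord_least (P : set a) :
  P !=set0 -> exists2 x, P x & forall y, P y -> ole x y.
Proof.
move=> [x Px]; have [|z [[zP zmin] _]] := @ole_wo a (mem P).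
  by exists x; rewrite inE.
by exists z => [|y Py]; [rewrite -inE | apply: zmin; rewrite inE].
Qed.

Lemma ole_total x y : ole x y \/ ole y x.
Proof.
have [|z Pz zmin] := @ord_least [set u | u = x \/ u = y].
  by exists x; left.
by case: Pz zmin => -> zmin; [left|right]; apply: zmin; [right|left].
Qed.

Lemma ole_refl x : ole x x.
Proof. by case: (ole_total x x). Qed.

Lemma ole_anti x y : ole x y -> ole y x -> x = y.
Proof.
(* x and y are both minima of {x, y}, and minima are unique. *)
move=> xy yx; have [|z [_ zU]] := @ole_wo a (mem [set u | u = x \/ u = y]).
  by exists x; rewrite inE; left.
have E w : w = x \/ w = y -> z = w.
  move=> wP; apply: zU; split=> [|u]; rewrite inE // => uP.
  by case: wP => ->; case: uP => ->; rewrite ?ole_refl.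
by rewrite -(E x) ?(E y) //; [right|left].
Qed.

Lemma ole_trans y x z : ole x y -> ole y z -> ole x z.
Proof.
move=> xy yz.
have [|u Pu umin] := @ord_least [set u | [\/ u = x, u = y | u = z]].
  by exists x; constructor 1.
case: Pu umin => -> umin.
- by apply: umin; constructor 3.
- have yx : ole y x by apply: umin; constructor 1.
  by rewrite (ole_anti xy yx).
- have zy : ole z y by apply: umin; constructor 2.
  by rewrite -(ole_anti yz zy).
Qed.

Lemma oltNle x y : olt x y <-> ~ ole y x.
Proof. by rewrite /olt; split=> /negP. Qed.

Lemma olt_irr x : ~ olt x x.
Proof. by move/oltNle; apply; apply: ole_refl. Qed.

Lemma oltW x y : olt x y -> ole x y.
Proof. by move/oltNle; case: (ole_total x y). Qed.

Lemma oltP x y : ole x y \/ olt y x.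
Proof. by rewrite /olt; case: (ole x y); [left|right]. Qed.

Lemma ole_lt_trans y x z : ole x y -> olt y z -> olt x z.
Proof. by move=> xy /oltNle yz; apply/oltNle => zx; apply/yz/(ole_trans zx). Qed.

Lemma olt_le_trans y x z : olt x y -> ole y z -> olt x z.
Proof. by move=> /oltNle xy yz; apply/oltNle => zx; apply/xy/(ole_trans yz). Qed.

Lemma ole_eqVlt x y : ole x y -> x = y \/ olt x y.
Proof. by move=> xy; have [yx|] := oltP y x; [left; apply: ole_anti|right]. Qed.

Lemma olt_wf : well_founded (fun x y => olt x y : Prop).
Proof.
move=> x; apply: contrapT => nx.
have [|y ny ymin] := @ord_least [set u | ~ Acc (fun x y => olt x y : Prop) u].
  by exists x.
apply: ny; constructor => z zy; apply: contrapT => nz.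
by move/oltNle: zy; apply; apply: ymin.
Qed.

End ord_order.

(** * Comparison of ordinals *)

Section embeddings.
Variables (a b : Ord) (f : a -> b).

Lemma oembed_lt : oembed f -> forall x y, olt (f x) (f y) = olt x y.
Proof. by move=> fe x y; rewrite /olt fe. Qed.

Lemma oembed_inj : oembed f -> injective f.
Proof. by move=> fe x y xy; apply: ole_anti; rewrite -fe xy ole_refl. Qed.

Lemma olt_mono_oembed : (forall x y, olt x y -> olt (f x) (f y)) -> oembed f.
Proof.
move=> fm x y; apply/idP/idP => [|xy].
  by have [//|/fm/oltNle] := oltP x y.
by have [->|/fm/oltW//] := ole_eqVlt xy; apply: ole_refl.
Qed.

Definition initial_range := forall u v, olt u (f v) -> range f u.

Lemma ord_ltE :
  (exists y, oembed f /\ range f = [set z | olt z y]) <->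
  [/\ oembed f, initial_range & exists y, ~ range f y].
Proof.
split=> [[y [fe fr]]|[fe fi fn]].
  split=> // [u v|]; last by exists y; rewrite fr => /olt_irr.
  have : range f (f v) by exists v.
  by rewrite !fr /= => vy uv; apply/(olt_le_trans uv)/oltW.
have [y ny ymin] := ord_least fn.
exists y; split=> //; apply/seteqP; split=> [z [v _ <-]|z /= zy].
  have [yf|//] := oltP y (f v); case: ny.
  by have [->|/fi//] := ole_eqVlt yf; exists v.
by apply: contrapT => nz; move/oltNle: zy; apply; apply: ymin.
Qed.

Lemma oembed_initial_le : oembed f -> initial_range -> ord_le a b.
Proof.
move=> fe fi; have [fs|fn] := pselect (forall y, range f y).
  right; exists f => //.
  have /choice[g gf] : forall y, exists x, f x = y.
    by move=> y; have [x _ <-] := fs y; exists x.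
  by exists g => // x; apply: (oembed_inj fe); rewrite gf.
by left; exists f; apply/ord_ltE; split=> //; apply/existsNP.
Qed.

End embeddings.

Lemma ord_le_initial (a b : Ord) :
  ord_le a b -> exists2 f : a -> b, oembed f & initial_range f.
Proof.
case=> [[f /ord_ltE[fe fi _]]|[f fe [g gf fg]]]; first by exists f.
by exists f => // u v _; exists (g u).
Qed.

Lemma ord_iso_refl (a : Ord) : ord_iso a a.
Proof. by exists id => //; exists id. Qed.

Lemma ord_iso_sym (a b : Ord) : ord_iso a b -> ord_iso b a.
Proof.
move=> [f fe [g gf fg]]; exists g; last by exists f.
by move=> x y; rewrite -fe !fg.
Qed.

Lemma ord_le_lt_trans (b a c : Ord) : ord_le a b -> ord_lt b c -> ord_lt a c.
Proof.
move=> /ord_le_initial[f fe fi] [g /ord_ltE[ge gi [y gy]]].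
exists (g \o f); apply/ord_ltE; split=> [u v|u v /=|].
- by rewrite /= ge fe.
- move=> ugf; have [w _ wu] := gi _ _ ugf; rewrite -wu oembed_lt // in ugf.
  by have [t _ tw] := fi _ _ ugf; exists t => //; rewrite /= tw.
- by exists y => -[x _ xy]; apply: gy; exists (f x).
Qed.

Lemma ord_lt_le_trans (b a c : Ord) : ord_lt a b -> ord_le b c -> ord_lt a c.
Proof.
move=> [f /ord_ltE[fe fi [y fy]]] /ord_le_initial[g ge gi].
exists (g \o f); apply/ord_ltE; split=> [u v|u v /=|].
- by rewrite /= ge fe.
- move=> ugf; have [w _ wu] := gi _ _ ugf; rewrite -wu oembed_lt // in ugf.
  by have [t _ tw] := fi _ _ ugf; exists t => //; rewrite /= tw.
- by exists (g y) => -[x _ /(oembed_inj ge) xy]; apply: fy; exists x.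
Qed.

Lemma ord_lt_trans (b a c : Ord) : ord_lt a b -> ord_lt b c -> ord_lt a c.
Proof. by move=> ab bc; apply: (ord_lt_le_trans ab); left. Qed.

Lemma ord_iso_le (a b : Ord) : ord_iso a b -> ord_le a b.
Proof. by right. Qed.

Lemma ord_iso_lt (a a' b : Ord) : ord_iso a a' -> ord_lt a b -> ord_lt a' b.
Proof. by move=> /ord_iso_sym/ord_iso_le; apply: ord_le_lt_trans. Qed.

Lemma ord_lt_iso (a b b' : Ord) : ord_iso b b' -> ord_lt a b -> ord_lt a b'.
Proof. by move=> /ord_iso_le bb ab; apply: ord_lt_le_trans bb. Qed.

Lemma ord_iso_trans (b a c : Ord) : ord_iso a b -> ord_iso b c -> ord_iso a c.
Proof.
move=> [f fe fb] [g ge gb]; exists (g \o f); last exact: bij_comp.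
by move=> x y; rewrite /= ge fe.
Qed.

(** An order embedding of a well-order into itself never decreases a point, so
    its range cannot be contained in a proper initial segment. *)
Lemma ord_lt_irr (a : Ord) : ~ ord_lt a a.
Proof.
move=> [f [y [fe fr]]].
have f_ge x : ole x (f x).
  elim/(well_founded_ind (@olt_wf a)): x => x IH.
  have [//|fx] := oltP x (f x); have := IH _ fx.
  by rewrite fe => xf; move/oltNle: fx.
have : range f (f y) by exists y.
by rewrite fr /= => /oltNle; apply.
Qed.

Lemma ord_lt_le_false (a b : Ord) : ord_lt a b -> ord_le b a -> False.
Proof. by move=> ab ba; apply: (@ord_lt_irr a); apply: ord_lt_le_trans ba. Qed.

(** By well-founded recursion, send [x] to the least point of [b] that is not
    the image of a smaller point. If this never gets stuck it embeds [a] as an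
    initial segment of [b]; if it first gets stuck at [x], then [b] is
    exhausted by the points below [x]. *)
Lemma ord_le_or_gt (a b : Ord) : ord_le a b \/ ord_lt b a.
Proof.
pose fresh x (rec : forall y : a, olt y x -> option b) : set b :=
  [set z | forall y (yx : olt y x), rec y yx <> Some z].
have /choice[least leastP] : forall P : set b, exists o : option b,
    if o is Some z then P z /\ forall y, P y -> ole z y else P = set0.
  move=> P; have [/ord_least[z Pz zmin]|P0] := pselect (P !=set0).
    by exists (Some z).
  by exists None; apply/seteqP; split=> // z Pz; case: P0; exists z.
pose F := Fix (@olt_wf a) (fun=> option b) (fun x rec => least (fresh x rec)).
have FE x : F x = least [set z | forall y, olt y x -> F y <> Some z].
  rewrite {1}/F Fix_eq // => {}x g h gh; congr least.
  apply/seteqP; split=> z /= H y yx.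
    by rewrite -gh; apply: H.
  by rewrite gh; apply: H.
have FS x z : F x = Some z -> (forall y, olt y x -> F y <> Some z) /\
    forall w, olt w z -> exists2 y, olt y x & F y = Some w.
  rewrite FE => E; have := leastP [set z | forall y, olt y x -> F y <> Some z].
  rewrite E => -[nz zmin]; split=> // w wz; apply: contrapT => nw.
  move/oltNle: wz; apply; apply: zmin => y yx Fy.
  by apply: nw; exists y.
have FN x : F x = None -> forall w, exists2 y, olt y x & F y = Some w.
  rewrite FE => E w.
  have := leastP [set z | forall y, olt y x -> F y <> Some z].
  rewrite E => /seteqP[/(_ w) + _]; apply: contra_notP => nw y yx Fy.
  by apply: nw; exists y.
have Fmono x y u v : olt x y -> F x = Some u -> F y = Some v -> olt u v.
  move=> xy Fx Fy; have [vu|//] := oltP v u.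
  have [E|vu'] := ole_eqVlt vu.
    by have [/(_ _ xy)] := FS _ _ Fy; rewrite E.
  have [_ /(_ _ vu')[z zx Fz]] := FS _ _ Fx.
  have [/(_ z)] := FS _ _ Fy; case=> //.
  exact: (olt_le_trans zx (oltW xy)).
have [sF|] := pselect (forall x, exists u, F x = Some u).
  left; have [f fE] := choice sF; apply: (@oembed_initial_le _ _ f).
    by apply: olt_mono_oembed => x y xy; apply: (Fmono x y).
  move=> u v uv; have [_ /(_ _ uv)[y _]] := FS _ _ (fE v).
  by rewrite fE => -[<-]; exists y.
move=> /existsNP[x0 nx0]; right.
have [|x Fx xmin] := @ord_least a [set x | F x = None].
  by exists x0; rewrite /=; case E: (F x0) => [u|] //; case: nx0; exists u.
have [g gx] := choice (fun w => let: ex_intro2 y yx Fy := FN x Fx w in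
  ex_intro (fun y => olt y x /\ F y = Some w) y (conj yx Fy)).
exists g, x; split=> [|].
  apply: olt_mono_oembed => u v uv; have [vu|//] := oltP (g v) (g u).
  case: (ole_eqVlt vu) => [E|lt].
    have [_] := gx u; rewrite -E; case: (gx v) => _ -> [E'].
    by move: uv; rewrite E' => /olt_irr.
  have := Fmono _ _ _ _ lt (gx v).2 (gx u).2.
  by move=> vu'; have /olt_irr := olt_le_trans uv (oltW vu').
apply/seteqP; split=> [_ [u _ <-]|y /= yx]; first by have [] := gx u.
case Fy: (F y) => [w|]; last by move/oltNle: yx; case; apply: xmin.
exists w => //; have [gwx Fw] := gx w.
have [le|lt] := oltP (g w) y; last first.
  by have /olt_irr := Fmono _ _ _ _ lt Fy Fw.
have [//|lt] := ole_eqVlt le.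
by have /olt_irr := Fmono _ _ _ _ lt Fw Fy.
Qed.

(** * Initial segments *)

Lemma seg_wo (a : Ord) (z : a) :
  well_order (fun x y : {x : a | olt x z} => ole (sval x) (sval y)).
Proof.
apply: antisymmetric_well_order => [[x xz] [y yz] /= /andP[xy yx]|A [x Ax]].
  by apply: eq_exist; apply: ole_anti.
have [|u [y Ay yu] umin] :=
    @ord_least a [set u | exists2 y : {x | olt x z}, y \in A & sval y = u].
  by exists (sval x), x.
by exists y; split=> // w Aw; rewrite yu; apply: umin; exists w.
Qed.

Definition seg (a : Ord) (z : a) : Ord := MkOrd (@seg_wo a z).

Lemma sval_seg_inj (a : Ord) (z : a) : injective (sval : seg z -> a).
Proof. by move=> [x xz] [y yz] /= xy; apply: eq_exist. Qed.

Lemma seg_lt (a : Ord) (z : a) : ord_lt (seg z) a.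
Proof.
exists sval, z; split=> //; apply/seteqP; split=> [_ [[x xz] _ <-] //|x xz].
by exists (exist _ x xz).
Qed.

Lemma seg_lt_seg (a : Ord) (y z : a) : olt y z -> ord_lt (seg y) (seg z).
Proof.
move=> yz; pose f (x : seg y) : seg z :=
  exist (fun x => olt x z) (sval x) (olt_le_trans (svalP x) (oltW yz)).
exists f, (exist _ y yz); split=> //; apply/seteqP; split=> [_ [x _ <-]|].
  exact: (svalP x).
move=> [x xz] xy; exists (exist _ x xy) => //.
exact: sval_seg_inj.
Qed.

Lemma ord_lt_seg (a b : Ord) : ord_lt b a -> exists z : a, ord_iso b (seg z).
Proof.
move=> [f [z [fe fr]]]; exists z.
have fz x : olt (f x) z by have : range f (f x) by []; rewrite fr.
have /choice[g gf] : forall y : seg z, exists x, f x = sval y.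
  move=> [y yz] /=; have : range f y by rewrite fr.
  by case=> x _ <-; exists x.
exists (fun x => exist _ (f x) (fz x)) => //; exists g => [x|y].
  by apply: (oembed_inj fe); rewrite gf.
by apply: sval_seg_inj; rewrite /= gf.
Qed.

Lemma seg_lt_segP (a : Ord) (y z : a) : ord_lt (seg y) (seg z) <-> olt y z.
Proof.
split=> [yz|]; last exact: seg_lt_seg.
have [zy|//] := oltP z y; case: (ord_lt_le_false yz).
have [->|/seg_lt_seg] := ole_eqVlt zy; last by left.
by right; apply: ord_iso_refl.
Qed.

Lemma ord_lt_segP (a b : Ord) (z : a) :
  ord_lt b (seg z) -> exists2 y : a, olt y z & ord_iso b (seg y).
Proof.
move=> bz; have [y iy] := ord_lt_seg (ord_lt_trans bz (seg_lt z)).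
by exists y => //; apply/seg_lt_segP/(ord_iso_lt iy).
Qed.

(** * Cardinalities *)

Definition embeds (T U : Type) := exists f : T -> U, injective f.

Lemma card_leTP (T U : Type) : [set: T] #<= [set: U] <-> embeds T U.
Proof.
split=> [/card_leP[f]|[f fi]].
  exists (fun x => val (f (to_setT x))) => x y /val_inj/inj.
  by rewrite !inE => /(_ I I)/(congr1 val).
have [_ []] := @injfunPex T U setT setT.
  by exists f => // x y _ _; apply: fi.
by move=> g; apply: inj_card_le g.
Qed.

Lemma embeds_trans (U T V : Type) : embeds T U -> embeds U V -> embeds T V.
Proof. by move=> [f fi] [g gi]; exists (g \o f); apply: inj_comp. Qed.

Lemma embeds_pair (T T' U U' : Type) :
  embeds T U -> embeds T' U' -> embeds (T * T') (U * U').
Proof.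
move=> [f fi] [g gi]; exists (fun p => (f p.1, g p.2)).
by move=> [x y] [x' y'] /= [/fi-> /gi->].
Qed.

Lemma embeds_leftinv (T U : Type) (f : T -> U) (t0 : T) :
  injective f -> exists g : U -> T, cancel f g.
Proof.
move=> fi.
have /choice[g gP] : forall u, exists t, forall t', f t' = u -> t = t'.
  move=> u; have [[t <-]|nt] := pselect (exists t, f t = u).
    by exists t => t' /fi.
  by exists t0 => t' tu; case: nt; exists t'.
by exists g => t; apply: gP.
Qed.

Lemma bigcup_void (T X : Type) (A : T -> set X) :
  ~ (exists t : T, True) -> \bigcup_t A t = set0.
Proof. by move=> nT; apply/seteqP; split=> // x [t _ _]; case: nT; exists t. Qed.

Lemma bigcup_cancel (T U X : Type) (A : T -> set X) (f : T -> U) (h : U -> T) :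
  cancel f h -> \bigcup_t A t = \bigcup_u A (h u).
Proof.
move=> fh; apply/seteqP; split=> [x [t _ At]|x [u _ Au]]; last by exists (h u).
by exists (f t) => //; rewrite fh.
Qed.

Lemma ord_le_embeds (a b : Ord) : ord_le a b -> embeds a b.
Proof. by move=> /ord_le_initial[f /oembed_inj fi _]; exists f. Qed.

(** Hilbert's hotel: shift a copy of the natural numbers by one. *)
Lemma embeds_option (T : Type) : infinite_set [set: T] -> embeds (option T) T.
Proof.
move=> /infiniteP/card_leTP[h hi].
have /choice[p pP] : forall t, exists o : option nat,
    if o is Some n then h n = t else forall n, h n <> t.
  move=> t; have [[n nt]|nt] := pselect (exists n, h n = t).
    by exists (Some n).
  by exists None => n nt'; case: nt; exists n.
exists (fun o => if o is Some t then if p t is Some n then h n.+1 else t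
                 else h 0).
move=> [t|] [u|] //=.
- have := pP t; have := pP u; case: (p t) => [n|]; case: (p u) => [m|].
  + by move=> <- <- /hi[->].
  + by move=> /[swap] _ /[swap] <- /(_ n.+1).
  + by move=> _ /(_ m.+1) /[swap] <-.
  + by move=> _ _ ->.
- have := pP t; case: (p t) => [n _ /hi//|/(_ 0)] + E.
  by rewrite E.
- have := pP u; case: (p u) => [n _ /hi//|/(_ 0)] + E.
  by rewrite E.
Qed.

Lemma seg_restrict (a : Ord) (x : a) : exists h : a -> option (seg x),
  forall y, if h y is Some u then sval u = y else ~ olt y x.
Proof.
have /choice[h hP] : forall y, exists o : option (seg x),
    if o is Some u then sval u = y else ~ olt y x.
  move=> y; have [yx|nyx] := pselect (olt y x); last by exists None.
  by exists (Some (exist _ y yx)).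
by exists h.
Qed.

(** A maximum could be removed without changing the cardinality. *)
Lemma cardinal_no_max (k : Ord) : is_cardinal k -> infinite_set [set: k] ->
  forall x : k, exists y, olt x y.
Proof.
move=> kc ki x; apply: contrapT => nx.
have xmax y : ole y x.
  by have [//|xy] := oltP y x; case: nx; exists y.
have /negP := kc _ (seg_lt x); apply.
rewrite card_eq_le; apply/andP; split; apply/card_leTP.
  by exists sval; apply: sval_seg_inj.
apply: (@embeds_trans (option (seg x))).
  have [h hP] := seg_restrict x; exists h => y z yz.
  have E w : ~ olt w x -> w = x.
    by move=> /oltNle nw; apply: ole_anti (xmax _) _; apply: contrapT.
  have := hP y; have := hP z; rewrite -yz; case: (h y) => [u <- <- //|].
  by move=> /E-> /E->.
apply: embeds_option => fs.
have : finite_set ([set: k] `\` [set x]).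
  apply: sub_finite_set (finite_image (sval : seg x -> k) fs).
  move=> y [_ /= yx]; have [E|lt] := ole_eqVlt (xmax y) => //.
  by exists (exist _ y lt).
exact: infinite_setD.
Qed.

(** When 2^<k = k, pairs are coded by bounded subsets: the pair (x, y) by the
    set {x, y}, regarded as a binary sequence whose length, one of two
    successive bounds, tells the order of the coordinates. This avoids the
    general theorem on squares of infinite cardinals. *)
Lemma two_lt_eq_square (k : Ord) :
  (forall x : k, exists y, olt x y) -> two_lt_eq k -> embeds (k * k) k.
Proof.
move=> /choice[S Slt]; rewrite /two_lt_eq card_eq_le => /andP[/card_leTP kk _].
apply: embeds_trans kk.
pose len (p : k * k) := if ole p.1 p.2 then S p.2 else S (S p.1).
pose code (p : k * k) : binseq k :=
  existT _ (len p) (fun i => `[< sval i = p.1 \/ sval i = p.2 >]).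
pose supp (s : binseq k) :=
  [set i | exists2 j : {i | olt i (tag s)}, sval j = i & tagged s j].
have supp_code p : supp (code p) = [set i | i = p.1 \/ i = p.2].
  have [lt1 lt2] : olt p.1 (len p) /\ olt p.2 (len p).
    rewrite /len; have [le|lt] := oltP p.1 p.2.
      by rewrite le; split=> //; apply: ole_lt_trans le _.
    rewrite (negbTE lt); have lt' := olt_le_trans (Slt p.1) (oltW (Slt _)).
    by split=> //; apply: olt_le_trans lt (oltW lt').
  apply/seteqP; split=> [_ [j <- /= /asboolP]|i /= ip] //.
  have lti : olt i (len p) by case: ip => ->.
  by exists (exist _ i lti) => //; apply/asboolP.
exists code => p q pq.
have := congr1 supp pq; rewrite !supp_code => /seteqP[pq1 qp1].
have : len p = len q by apply: (congr1 (@tag _ _) pq).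
have := pq1 p.1 (or_introl erefl); have := pq1 p.2 (or_intror erefl).
have := qp1 q.1 (or_introl erefl); have := qp1 q.2 (or_intror erefl).
rewrite {code supp_code pq pq1 qp1 supp} /len; case: p q => [x y] [x' y'] /=.
move=> D C B A E.
have [[-> ->] //|[xy yx]] : (x = x' /\ y = y') \/ (x = y' /\ y = x').
  by case: A => ?; case: B => ?; case: C => ?; case: D => ?; subst; auto.
subst x' y'; move: E.
have Sne z : S z <> z by move=> E; have := Slt z; rewrite E => /olt_irr.
have [le|lt] := oltP x y; have [le'|lt'] := oltP y x.
- by rewrite (ole_anti le le').
- by rewrite le (negbTE lt') => /esym/Sne.
- by rewrite le' (negbTE lt) => /Sne.
- by have /olt_irr := olt_le_trans lt (oltW lt').
Qed.

(** * The Borel hierarchy *)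

Section hierarchy.
Variables (g : Ord) (X : topologicalType).

(** The recursive premises of [gSigma] sit under a conjunction, so this
    induction principle has to be proved by hand. *)
Lemma gSigma_nested_ind (P : Ord -> set X -> Prop) :
  (forall a A, ord_iso a ord1 -> open A -> P a A) ->
  (forall (a d : Ord) (B : d -> set X) (b : d -> Ord),
     ord_lt ord1 a -> ord_lt d g ->
     (forall xi, [/\ ord_le ord1 (b xi), ord_lt (b xi) a,
                     gSigma g (b xi) (B xi) & P (b xi) (B xi)]) ->
     P a (\bigcup_xi ~` B xi)) ->
  forall a A, gSigma g a A -> P a A.
Proof.
move=> Popen Pcup; refine (fix IH a A (S : gSigma g a A) {struct S} : P a A :=
  match S with
  | gSigma_open _ _ a1 oA => Popen _ _ a1 oA
  | gSigma_bigcup _ _ _ b a1 dg H => Pcup _ _ _ b a1 dg (fun xi =>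
      match H xi with And3 b1 ba SB => And4 b1 ba SB (IH _ _ SB) end)
  end).
Qed.

Lemma gSigma_inv (a : Ord) (A : set X) : gSigma g a A ->
  (ord_iso a ord1 /\ open A) \/ exists (d : Ord) (B : d -> set X) (b : d -> Ord),
    [/\ ord_lt d g, forall xi, ord_lt (b xi) a /\ gSigma g (b xi) (B xi) &
        A = \bigcup_xi ~` B xi].
Proof.
case=> [{}a {}A a1 oA|{}a d B b _ dg H]; [by left|right].
by exists d, B, b; split=> // xi; have [] := H xi.
Qed.

Lemma gSigma_iso (a a' : Ord) : ord_iso a a' -> gSigma g a `<=` @gSigma g X a'.
Proof.
move=> aa A SA; case: SA aa => {a A} [a A a1 oA|a d B b a1 dg H] aa.
  by apply: gSigma_open => //; apply: ord_iso_trans a1; apply: ord_iso_sym.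
apply: gSigma_bigcup dg _; first exact: ord_lt_iso a1.
by move=> xi; have [h1 h2 h3] := H xi; split; [|exact: ord_lt_iso h2|].
Qed.

Lemma gBor_open (A : set X) : open A -> gBor g A.
Proof. exact: sub_gen_smallest. Qed.

Lemma gBor_is_closed : gBor_closed g (@gBor g X).
Proof.
split=> [A BA F [FC Fo]|d A dg BA F [FC Fo]]; first by apply: (FC).1; apply: BA.
by apply: (FC).2 => // xi; apply: BA.
Qed.

Lemma gBor_setC (A : set X) : gBor g A -> gBor g (~` A).
Proof. exact: gBor_is_closed.1. Qed.

Lemma gSigma_gBor (a : Ord) : gSigma g a `<=` @gBor g X.
Proof.
apply: gSigma_nested_ind => [{}a A _|{}a d B b _ dg H]; first exact: gBor_open.
by apply: gBor_is_closed.2 => // xi; apply: gBor_setC; have [] := H xi.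
Qed.

(** Since ordinals are well-ordered and the classes depend only on the order
    type, any stage below [c] that exhausts the Borel sets yields a least
    one. *)
Lemma borel_order_ltP (c : Ord) : borel_order_lt g X c <->
  exists a : Ord, [/\ ord_le ord1 a, ord_lt a c & gSigma g a = @gBor g X].
Proof.
split=> [[a [a1 aB _] ac]|[a [a1 ac aB]]]; first by exists a.
have isoE b b' : ord_iso b b' -> gSigma g b = @gSigma g X b'.
  move=> bb; apply/seteqP; split; apply: gSigma_iso => //.
  exact: ord_iso_sym.
have [z az] := ord_lt_seg ac.
have [|y [y1 yB] ymin] :=
    @ord_least c [set y | ord_le ord1 (seg y) /\ gSigma g (seg y) = @gBor g X].
  exists z; split; last by rewrite -(isoE _ _ az).
  have [//|z1] := ord_le_or_gt ord1 (seg z).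
  by case: (ord_lt_le_false (ord_iso_lt (ord_iso_sym az) z1) a1).
exists (seg y); last exact: seg_lt.
split=> // b b1 bB; have [//|by'] := ord_le_or_gt (seg y) b.
have [x xy bx] := ord_lt_segP by'; move/oltNle: xy; case; apply: ymin; split.
  have [//|x1] := ord_le_or_gt ord1 (seg x).
  by case: (ord_lt_le_false (ord_iso_lt (ord_iso_sym bx) x1) b1).
by rewrite -(isoE _ _ bx).
Qed.

Lemma collapses_starP (gs : Ord) :
  is_star g gs -> (collapses g X <-> borel_order_lt g X gs).
Proof.
move=> gsP; split; last by exists gs.
move=> [hs [_ _ hsmin] [a ao ah]]; exists a => //.
by have [gsr ggs _] := gsP; apply: ord_lt_le_trans ah _; apply: hsmin.
Qed.

End hierarchy.

Lemma gSigma_mono (g g' : Ord) (X : topologicalType) (a : Ord) :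
  ord_le g g' -> gSigma g a `<=` @gSigma g' X a.
Proof.
move=> gg A; elim/gSigma_nested_ind => {a A} [a A|a d B b a1 dg H].
  exact: gSigma_open.
apply: (@gSigma_bigcup _ _ _ _ _ b) => //; first exact: ord_lt_le_trans gg.
by move=> xi; have [? ? _ ?] := H xi.
Qed.

Lemma gBor_mono (g g' : Ord) (X : topologicalType) :
  ord_le g g' -> @gBor g X `<=` @gBor g' X.
Proof.
move=> gg; apply: smallest_sub; last exact: gBor_open.
have [BC BU] := gBor_is_closed g' X; split=> // d A dg.
by apply: BU; apply: ord_lt_le_trans gg.
Qed.

(** * The successor of a singular cardinal *)

Section successor_of_singular.
Variables (k kp : Ord).
Hypothesis k_sing : singular_cardinal k.
Hypothesis kp_succ : is_succ_cardinal k kp.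
Hypothesis k_two : two_lt_eq k.

Let k_card : is_cardinal k. Proof. by case: k_sing. Qed.

Lemma singular_infinite : infinite_set [set: k].
Proof. by case: k_sing => _ + _; apply: contra_not => /finite_set_countable. Qed.

Let k_lt_kp : ord_lt k kp. Proof. by case: kp_succ. Qed.

Lemma singular_no_max (x : k) : exists y, olt x y.
Proof. exact: cardinal_no_max k_card singular_infinite x. Qed.

Lemma embeds_square : embeds (k * k) k.
Proof. exact: two_lt_eq_square singular_no_max k_two. Qed.

Lemma embeds_k_pair (T U : Type) : embeds T k -> embeds U k -> embeds (T * U) k.
Proof. by move=> /embeds_pair h /h /embeds_trans; apply; apply: embeds_square. Qed.

Lemma embeds_k_option (T : Type) : embeds T k -> embeds (option T) k.
Proof.
move=> [f fi]; apply: embeds_trans (embeds_option singular_infinite).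
by exists (omap f); apply: inj_omap.
Qed.

Lemma nat_embeds_k : embeds nat k.
Proof. by apply/card_leTP/infiniteP/singular_infinite. Qed.

Lemma bool_embeds_k : embeds bool k.
Proof. by apply: embeds_trans nat_embeds_k; exists nat_of_bool; do 2![case]. Qed.

Lemma k_inhabited : exists x : k, True.
Proof. by have [f _] := nat_embeds_k; exists (f 0). Qed.

(** Otherwise the least ordinal equinumerous with [d] would be a cardinal
    strictly between [k] and its successor. *)
Lemma lt_succ_embeds (d : Ord) : ord_lt d kp -> embeds d k.
Proof.
move=> dkp; have [z0 dz0] := ord_lt_seg dkp.
have [|z [dz zd] zmin] := @ord_least kp
    [set z | embeds d (seg z) /\ embeds (seg z) d].
  by exists z0; split; apply: ord_le_embeds; right=> //; apply: ord_iso_sym.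
have zc : is_cardinal (seg z).
  move=> a /ord_lt_segP[y yz ay]; apply/negP => /card_eqPle[_ /card_leTP za].
  have /oltNle := yz; apply; apply: zmin.
  have ya := ord_le_embeds (ord_iso_le (ord_iso_sym ay)).
  have az : embeds a (seg z).
    exact: ord_le_embeds (or_introl (ord_iso_lt (ord_iso_sym ay)
      (seg_lt_seg yz))).
  split; last exact: embeds_trans (embeds_trans ya az) zd.
  apply: embeds_trans (embeds_trans dz za) _.
  exact: ord_le_embeds (ord_iso_le ay).
have [zk|kz] := ord_le_or_gt (seg z) k.
  exact: embeds_trans dz (ord_le_embeds zk).
have [_ _ /(_ _ zc kz) le] := kp_succ.
by case: (ord_lt_le_false (seg_lt z) le).
Qed.

Lemma seg_succ_embeds (z : kp) : embeds (seg z) k.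
Proof. exact: lt_succ_embeds (seg_lt z). Qed.

Lemma succ_not_embeds : ~ embeds kp k.
Proof.
move=> kpk; have [kpc _ _] := kp_succ; have /negP := kpc _ k_lt_kp; apply.
by apply/card_eqPle; split; apply/card_leTP => //; apply: ord_le_embeds; left.
Qed.

(** Regularity of the successor cardinal: it is not a union of [k] many initial
    segments, each of size at most [k]. *)
Lemma succ_bound (T : Type) (f : T -> kp) :
  embeds T k -> exists w, forall t, olt (f t) w.
Proof.
move=> Tk; apply: contrapT => nw; apply: succ_not_embeds.
have /choice[t tP] : forall w, exists t, ole w (f t).
  move=> w; apply: contrapT => nt; apply: nw; exists w => t.
  by apply/oltNle => wt; apply: nt; exists t.
have /choice[h hP] : forall x : kp, exists h : kp -> option k,
    forall v w, ole v x -> ole w x -> h v = h w -> v = w.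
  move=> x; have [h hP] := seg_restrict x; have [g gi] := seg_succ_embeds x.
  exists (omap g \o h) => v w vx wx /= /(inj_omap gi) vw.
  have E u : ole u x -> ~ olt u x -> u = x by move=> /ole_eqVlt[].
  have := hP v; have := hP w; rewrite -vw; case: (h v) => [u <- <- //|].
  by move=> /(E _ wx)-> /(E _ vx)->.
apply: (@embeds_trans (T * option k)).
  exists (fun w => (t w, h (f (t w)) w)) => v w [tvw].
  by rewrite tvw; apply: hP; rewrite // -tvw.
by apply: embeds_k_pair => //; apply: embeds_k_option; exists id.
Qed.

Lemma succ_above (x : kp) : exists w, olt x w.
Proof.
have [|w wP] := @succ_bound unit (fun=> x).
  by have [c _] := k_inhabited; exists (fun=> c) => -[] [].
by exists w; apply: (wP tt).
Qed.

Lemma succ_regular : regular_cardinal kp.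
Proof.
have kk : embeds k kp by apply: ord_le_embeds; left.
split; first by case: kp_succ.
  apply/infiniteP/card_leTP.
  exact: embeds_trans nat_embeds_k kk.
split; first by exists id => y; exists y; apply: ole_refl.
move=> e [f fc]; have [//|ekp] := ord_le_or_gt kp e.
have [w fw] := succ_bound f (lt_succ_embeds ekp).
by have [x /(olt_le_trans (fw x))/olt_irr] := fc w.
Qed.

(** A regular cardinal is not isomorphic to [k], whose cofinality is smaller. *)
Lemma regular_ge_singular_ge_succ (l : Ord) :
  regular_cardinal l -> ord_le k l -> ord_le kp l.
Proof.
move=> [lc _ [_ lcof]] [kl|kl]; first by have [_ _] := kp_succ; apply.
have [_ _ [d [[f fc] _] dk]] := k_sing; have [g ge [h _ gh]] := kl.
have ld : ord_le l d.
  apply: lcof; exists (g \o f) => y; have [x yx] := fc (h y).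
  by exists x; rewrite -(gh y) /= ge.
by case: (ord_lt_le_false (ord_lt_iso kl dk) ld).
Qed.

Lemma star_singular : is_star k kp.
Proof.
split; [exact: succ_regular|by left|exact: regular_ge_singular_ge_succ].
Qed.

Lemma star_succ : is_star kp kp.
Proof.
by split=> //; [exact: succ_regular|apply/ord_iso_le/ord_iso_refl].
Qed.

(** * Comparison of the two hierarchies *)

(** A union of at most [k] sets is a union of fewer than [k] unions of fewer
    than [k] sets: cut [k] along a cofinal map from its cofinality. *)
Lemma singular_split : exists (c : Ord) (f : c -> k), ord_lt c k /\
  forall (X : Type) (A : k -> set X),
    \bigcup_x A x = \bigcup_i \bigcup_(x : seg (f i)) A (sval x).
Proof.
have [_ _ [c [[f fc] _] ck]] := k_sing; exists c, f; split=> // X A.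
apply/seteqP; split=> [t [x _ Axt]|t [i _ [x _ Axt]]]; last by exists (sval x).
have [y xy] := singular_no_max x; have [i yi] := fc y.
by exists i => //; exists (exist _ x (olt_le_trans xy yi)).
Qed.

Section borel_sets.
Variable X : topologicalType.

Lemma gBor_bigcup (T : Type) (A : T -> set X) :
  embeds T k -> (forall t, gBor kp (A t)) -> gBor kp (\bigcup_t A t).
Proof.
move=> [f fi] BA; have [[t0 _]|nT] := pselect (exists t : T, True); last first.
  by rewrite (bigcup_void A nT); apply: gBor_open; apply: open0.
have [h fh] := embeds_leftinv t0 fi.
by rewrite (bigcup_cancel A fh); apply: (gBor_is_closed kp X).2.
Qed.

Lemma gBor_setI (A B : set X) : gBor kp A -> gBor kp B -> gBor kp (A `&` B).
Proof.
move=> BA BB; rewrite -[A `&` B]setCK setCI; apply: gBor_setC.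
have -> : ~` A `|` ~` B = \bigcup_(b : bool) if b then ~` A else ~` B; last first.
  apply: (gBor_bigcup bool_embeds_k) => -[]; first exact: gBor_setC BA.
  exact: gBor_setC BB.
apply/seteqP; split=> [x [nA|nB]|x [[] _ nx]].
- by exists true.
- by exists false.
- by left.
- by right.
Qed.

(** Closure under unions of fewer than [k] sets, applied twice along a cofinal
    map, gives closure under unions of [k] sets. *)
Lemma gBor_succ : @gBor k X = @gBor kp X.
Proof.
apply/seteqP; split; first by apply: gBor_mono; left.
apply: smallest_sub; last exact: gBor_open.
have [BC BU] := gBor_is_closed k X; split=> // d A /lt_succ_embeds[e ei] BA.
have [[t0 _]|nT] := pselect (exists t : d, True); last first.
  by rewrite (bigcup_void A nT); apply: gBor_open; apply: open0.
have [h eh] := embeds_leftinv t0 ei.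
have [c [f [ck kE]]] := singular_split; rewrite (bigcup_cancel A eh) kE.
by apply: (BU) => // i; apply: (BU) => //; apply: seg_lt.
Qed.

(** A family of sets is bounded when it is exhausted before some stage of the
    [k]-Borel hierarchy that lies below the successor of [k]. Asking only that
    each member appear at some earlier stage makes the notion monotone in the
    stage, although open sets need not be of class Sigma_2. *)
Definition bounded (F : set (set X)) := exists w : kp, forall A, F A ->
  exists z : kp, [/\ olt z w, ord_le ord1 (seg z) & gSigma k (seg z) A].

Lemma bounded_sub (F G : set (set X)) : F `<=` G -> bounded G -> bounded F.
Proof. by move=> FG [w wP]; exists w => A /FG/wP. Qed.

Lemma bounded_bigcup (T : Type) (F : T -> set (set X)) :
  embeds T k -> (forall t, bounded (F t)) -> bounded (\bigcup_t F t).
Proof.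
move=> Tk /choice[w wP]; have [v vP] := succ_bound w Tk.
exists v => A [t _ /wP[z [zw z1 SA]]]; exists z; split=> //.
exact: olt_le_trans zw (oltW (vP t)).
Qed.

Lemma bounded_setU (F G : set (set X)) :
  bounded F -> bounded G -> bounded (F `|` G).
Proof.
move=> bF bG.
apply: (@bounded_sub _ (\bigcup_(b : bool) if b then F else G)).
  by move=> A [FA|GA]; [exists true|exists false].
by apply: bounded_bigcup bool_embeds_k _; case.
Qed.

Lemma ord1_lt_k : ord_lt ord1 k.
Proof.
have [k1|//] := ord_le_or_gt k ord1; have [x _] := k_inhabited.
have [y xy] := singular_no_max x; have [f fi] := ord_le_embeds k1.
have E : x = y by apply: fi; case: (f x); case: (f y).
by move: xy; rewrite E => /olt_irr.
Qed.

Lemma succ_one : exists z : kp, ord_iso ord1 (seg z).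
Proof. exact/ord_lt_seg/(ord_lt_trans ord1_lt_k). Qed.

Lemma bounded_open : bounded open.
Proof.
have [z z1] := succ_one; have [w zw] := succ_above z; exists w => A oA.
exists z; split=> //; first exact: ord_iso_le.
by apply: gSigma_open => //; apply: ord_iso_sym.
Qed.

Definition unions_of_complements (F : set (set X)) : set (set X) :=
  [set U | exists (d : Ord) (B : d -> set X),
    [/\ ord_lt d k, forall xi, F (B xi) & U = \bigcup_xi ~` B xi]].

Lemma unions_of_complementsC (F : set (set X)) (A : set X) :
  F A -> unions_of_complements F (~` A).
Proof.
move=> FA; exists ord1, (fun=> A); split=> //; first exact: ord1_lt_k.
by apply/seteqP; split=> [x nA|x []//]; exists tt.
Qed.

(** The strict bound on the stages of the members of [F] is itself a stage that
    contains all short unions of their complements. *)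
Lemma bounded_gSigma_stage (F : set (set X)) : bounded F ->
  exists w : kp, ord_lt ord1 (seg w) /\
    unions_of_complements F `<=` gSigma k (seg w).
Proof.
move=> [w wP]; have [z1 z1P] := succ_one.
have [v vP] := succ_bound (fun b : bool => if b then w else z1) bool_embeds_k.
have v1 : ord_lt ord1 (seg v).
  exact: ord_iso_lt (ord_iso_sym z1P) (seg_lt_seg (vP false)).
exists v; split=> // _ [d [B [dk FB ->]]].
have /choice[z zP] := fun xi => wP _ (FB xi).
apply: (gSigma_bigcup (b := fun xi => seg (z xi))) => // xi.
have [zw ? ?] := zP xi; split=> //; apply: seg_lt_seg.
exact: olt_le_trans zw (oltW (vP true)).
Qed.

Lemma bounded_unions_of_complements (F : set (set X)) :
  bounded F -> bounded (unions_of_complements F).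
Proof.
move=> /bounded_gSigma_stage[w [w1 Fw]]; have [v wv] := succ_above w.
by exists v => A /Fw SA; exists w; split=> //; left.
Qed.

(** Each stage of the [k]^+-hierarchy costs three stages of the [k]-hierarchy:
    a union of [k] complements is a union, over the cofinality of [k], of
    shorter unions of complements, and passing from the latter to their
    complements takes one further stage. *)
Lemma bounded_gSigma_succ (a : Ord) : ord_lt a kp -> bounded (gSigma kp a).
Proof.
move=> /ord_lt_seg[z az].
apply: (bounded_sub (gSigma_iso az)) => {a az}.
elim/(well_founded_ind (@olt_wf kp)): z => z IH.
pose F := \bigcup_(y : seg z) @gSigma kp X (seg (sval y)).
pose U := unions_of_complements.
(* The first U forms the short unions, the second their complements, and the
   third the union over the cofinality. *)
apply: (@bounded_sub _ (open `|` U (U (U F)))); last first.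
  apply: bounded_setU bounded_open _.
  do 3 apply: bounded_unions_of_complements.
  by apply: bounded_bigcup (seg_succ_embeds z) _ => -[y yz]; apply: IH.
move=> A /gSigma_inv[[_ oA]|[d [B [b [/lt_succ_embeds[e ei] bz ->]]]]].
  by left.
have [[t0 _]|nT] := pselect (exists t : d, True); last first.
  by left; rewrite (bigcup_void _ nT); apply: open0.
have FB t : F (B t).
  have [ltb Sb] := bz t; have [y yz iy] := ord_lt_segP ltb.
  by exists (exist _ y yz) => //; apply: gSigma_iso iy _ Sb.
have [h eh] := embeds_leftinv t0 ei; right.
rewrite (bigcup_cancel (fun t => ~` B t) eh).
have [c [f [ck ->]]] := singular_split.
exists c, (fun i => ~` \bigcup_(x : seg (f i)) ~` B (h (sval x))); split=> //.
  move=> i; apply: unions_of_complementsC.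
  exists (seg (f i)), (fun x => B (h (sval x))); split=> //; first exact: seg_lt.
by apply: eq_bigcupr => i _; rewrite setCK.
Qed.

(** The [k]-hierarchy is included in the [k]^+-hierarchy stage by stage, and
    conversely each stage of the latter is bounded in the former; as both
    generate the same sets, they collapse together. *)
Lemma borel_order_lt_succ : borel_order_lt k X kp <-> borel_order_lt kp X kp.
Proof.
split=> /borel_order_ltP[a [a1 akp aB]]; apply/borel_order_ltP.
  exists a; split=> //; apply/seteqP; split; first exact: gSigma_gBor.
  by rewrite -gBor_succ -aB; apply: gSigma_mono; left.
have bB : bounded (@gBor k X).
  by rewrite gBor_succ -aB; apply: bounded_gSigma_succ.
have [w [w1 Bw]] := bounded_gSigma_stage bB.
exists (seg w); split; [by left|exact: seg_lt|].
apply/seteqP; split; first exact: gSigma_gBor.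
move=> A BA; rewrite -[A]setCK; apply/Bw/unions_of_complementsC.
exact: gBor_setC.
Qed.

Lemma collapses_succ : collapses k X <-> collapses kp X.
Proof.
rewrite (collapses_starP X star_singular) (collapses_starP X star_succ).
exact: borel_order_lt_succ.
Qed.

End borel_sets.
(** * The space ^k 2 *)

Definition initial_part (y : cantor_space k) (a : k) : binseq k :=
  existT _ a (fun i => y (sval i)).

Lemma initial_partP (y z : cantor_space k) (a : k) :
  cone (initial_part y a) z <-> forall i, olt i a -> z i = y i.
Proof.
split=> [yz i ia|yz [i ia]] /=; last exact: yz.
by have /= := yz (exist _ i ia).
Qed.

Lemma cone_initial_part (s : binseq k) (y : cantor_space k) :
  cone s y -> cone (initial_part y (tag s)) `<=` cone s.
Proof. by move=> sy z /initial_partP yz i; rewrite -sy; apply: yz; case: i. Qed.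

Lemma cone_open (s : binseq k) : open (cone s).
Proof.
exists [set cone s]; last by rewrite bigcup_set1.
by move=> _ ->; apply: finI_from1; exists s.
Qed.

(** Finitely many cones around a point contain the cone of its initial part of
    the largest length, so the cones form a base of the bounded topology. *)
Lemma finI_cone (V : set (cantor_space k)) (y : cantor_space k) :
  finI_from (range (@cone k)) id V -> V y ->
  exists a, cone (initial_part y a) `<=` V.
Proof.
move=> [N NC <-] Ny.
suff [a aN] : exists a, forall C, C \in enum_fset N ->
    cone (initial_part y a) `<=` C by exists a => z az C /aN; apply.
have {}Ny C : C \in enum_fset N -> C y by move=> CN; apply: Ny.
have {}NC C : C \in enum_fset N -> exists s, C = cone s.
  by move=> /NC; rewrite inE => -[s _ <-]; exists s.
elim: {N}(enum_fset N) Ny NC => [|C N IH] Ny NC.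
  by have [x _] := k_inhabited; exists x.
have sub D : D \in N -> D \in C :: N by rewrite inE orbC => ->.
have [||a aN] := IH; [by move=> D /sub/Ny|by move=> D /sub/NC|].
have [s Cs] := NC C (mem_head _ _).
have Cy := Ny C (mem_head _ _); rewrite {}Cs {C NC Ny sub} in Cy *.
pose b := if ole a (tag s) then tag s else a.
have [ab sb] : ole a b /\ ole (tag s) b.
  rewrite /b; case: (oltP a (tag s)) => [le|lt].
    by rewrite le; split=> //; apply: ole_refl.
  by rewrite (negbTE lt); split; [apply: ole_refl|apply: oltW].
have shrink c : ole c b -> cone (initial_part y b) `<=` cone (initial_part y c).
  move=> cb z /initial_partP bz; apply/initial_partP => i ic.
  exact/bz/(olt_le_trans ic).
exists b => D; rewrite inE => /orP[/eqP->|/aN aD].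
  by apply: subset_trans (cone_initial_part Cy); apply: shrink.
by apply: subset_trans aD; apply: shrink.
Qed.

Lemma open_cone (U : set (cantor_space k)) (y : cantor_space k) :
  open U -> U y -> exists2 s, cone s y & cone s `<=` U.
Proof.
move=> [D DfinI <-] [V DV Vy].
have [a aV] := finI_cone (DfinI _ DV) Vy.
exists (initial_part y a); first exact/initial_partP.
by move=> z /aV Vz; exists V.
Qed.

Lemma open_coordinate (x : k) : open [set y : cantor_space k | y x].
Proof.
have [a xa] := singular_no_max x.
have -> : [set y : cantor_space k | y x] =
    \bigcup_(y in [set y : cantor_space k | y x]) cone (initial_part y a).
  apply/seteqP; split=> [y yx|z [y /= yx /initial_partP/(_ _ xa)->]] //.
  by exists y => //; apply/initial_partP.
by apply: bigcup_open => y _; apply: cone_open.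
Qed.

(** * Universal sets *)

(** [W] parametrizes sets by binary codes in such a way that [f x] belonging to
    the set coded by a reindexing of [x] is a Borel condition on [x]; along an
    embedding of [T] into [k] this is what diagonalization needs, and arbitrary
    reindexings make the notion inductive. *)
Definition borel_codes (X : Type) (f : cantor_space k -> X) (T : Type)
    (W : (T -> bool) -> set X) :=
  forall r : T -> k,
    gBor kp [set x : cantor_space k | W (fun t => x (r t)) (f x)].

Section universal_sets.
Variables (X : topologicalType) (f : cantor_space k -> X) (B : k -> set X).
Hypothesis base : forall U : set X, open U ->
  exists D : set k, U = \bigcup_(x in D) B x.
Hypothesis f_base : forall x, gBor kp (f @^-1` B x).

Lemma gBor_coordinate (x : k) : gBor kp [set y : cantor_space k | y x].
Proof. by apply: gBor_open; apply: open_coordinate. Qed.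

Lemma universal_open : exists W : (k -> bool) -> set X,
  borel_codes f W /\ forall U, open U -> exists y, W y = U.
Proof.
exists (fun y => \bigcup_(x in [set x | y x]) B x); split=> [r|U /base[D ->]].
  have -> : [set x : cantor_space k |
      (\bigcup_(x0 in [set x0 | x (r x0)]) B x0) (f x)] =
    \bigcup_t ([set x : cantor_space k | x (r t)] `&` f @^-1` B t).
    by apply/seteqP; split=> [x [t xt Bt]|x [t _ [xt Bt]]]; exists t.
  apply: gBor_bigcup => [|t]; first by exists id.
  by apply: gBor_setI; [apply: gBor_coordinate|apply: f_base].
have DE : [set x | `[< D x >]] = D by apply/funext => x; apply: asboolE.
by exists (fun x => `[< D x >]); rewrite DE.
Qed.

(** For a > 1, a code for a set of class a lists, for each class below a and
    each index in [k], a bit telling whether the entry is used and a code of a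
    set of that class. *)
Lemma universal_gSigma (a : Ord) : ord_lt a kp ->
  exists (T : Type) (W : (T -> bool) -> set X),
    [/\ embeds T k, borel_codes f W &
        forall A, gSigma kp a A -> exists y, W y = A].
Proof.
move=> /ord_lt_seg[z az].
suff [T [W [Tk WB WS]]] : exists (T : Type) (W : (T -> bool) -> set X),
    [/\ embeds T k, borel_codes f W &
        forall A, gSigma kp (seg z) A -> exists y, W y = A].
  by exists T, W; split=> // A /(gSigma_iso az)/WS.
elim/(well_founded_ind (@olt_wf kp)): z {a az} => z IH.
have {IH} /choice[W WP] : forall v : seg z, exists W : (k -> bool) -> set X,
    borel_codes f W /\
    forall A, gSigma kp (seg (sval v)) A -> exists y, W y = A.
  move=> [v vz]; have [T [W [[e ei] WB WS]]] := IH v vz.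
  exists (fun y => W (y \o e)); split=> [r|A /WS[y <-]]; first exact: WB.
  have /choice[y' y'P] : forall x, exists b : bool,
      forall t, e t = x -> b = y t.
    move=> x; have [[t tx]|nt] := pselect (exists t, e t = x).
      by exists (y t) => t'; rewrite -tx => /ei->.
    by exists true => t tx; case: nt; exists t.
  by exists y'; congr W; apply/funext => t; apply: y'P.
have [z1|nz1] := pselect (ord_iso (seg z) ord1).
  have [W0 [W0B W0S]] := universal_open.
  exists k, W0; split=> //; first by exists id.
  by move=> A; rewrite gSigma1E //; apply: W0S.
pose T := (seg z * k * option k)%type.
pose V (y : T -> bool) (v : seg z) (x : k) :=
  [set u | y (v, x, None) /\ ~ W v (fun t => y (v, x, Some t)) u].
exists T, (fun y => \bigcup_v \bigcup_x V y v x); split.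
- apply: embeds_k_pair; last by apply: embeds_k_option; exists id.
  by apply: embeds_k_pair (seg_succ_embeds z) _; exists id.
- move=> r.
  have -> : [set x : cantor_space k |
      (\bigcup_v \bigcup_w V (fun t => x (r t)) v w) (f x)] =
    \bigcup_v \bigcup_w ([set x : cantor_space k | x (r (v, w, None))] `&`
      ~` [set x : cantor_space k |
           W v (fun t => x (r (v, w, Some t))) (f x)]).
    by apply/seteqP; split=> x [v _ [w _ Vx]]; exists v => //; exists w.
  apply: (gBor_bigcup (seg_succ_embeds z)) => v.
  apply: gBor_bigcup => [|w]; first by exists id.
  apply: gBor_setI; first exact: gBor_coordinate.
  by apply: gBor_setC; apply: (WP v).1 (fun t => r (v, w, Some t)).
- move=> A /gSigma_inv[[]//|[d [C [b [/lt_succ_embeds[e ei] bz ->]]]]].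
  have /choice[c cP] : forall t, exists c : seg z * (k -> bool),
      W c.1 c.2 = C t.
    move=> t; have [btz SC] := bz t; have [v vz iv] := ord_lt_segP btz.
    have [y yP] := (WP (exist _ v vz)).2 _ (gSigma_iso iv SC).
    by exists (exist _ v vz, y).
  pose y (p : T) := `[< exists t : d, [/\ p.1.1 = (c t).1, p.1.2 = e t &
    if p.2 is Some x then (c t).2 x else true] >].
  have yN v x : y (v, x, None) -> exists t, v = (c t).1 /\ x = e t.
    by move=> /asboolP[t [/= ? ? _]]; exists t.
  have yS t : (fun x => y ((c t).1, e t, Some x)) = (c t).2.
    apply/funext => x; apply/asboolP/idP => [[s [_ /= /ei <-]]|ctx] //.
    by exists t.
  exists y; apply/seteqP; split=> [u [v _ [x _ [/yN[t [-> ->]]]]]|u [t _ nCu]].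
    by rewrite yS cP; exists t.
  exists (c t).1 => //; exists (e t) => //; split; last by rewrite yS cP.
  by apply/asboolP; exists t.
Qed.

(** Cantor's diagonal argument: the set of codes x such that f x lies outside
    the set coded by x is Borel, but cannot be the preimage of a coded set. *)
Lemma diagonal (g a : Ord) :
  (forall D : set (cantor_space k), gBor kp D ->
     exists2 S : set X, gBor kp S & D = f @^-1` S) ->
  ord_le g kp -> ord_lt a kp -> gSigma g a <> @gBor kp X.
Proof.
move=> lift gkp /universal_gSigma[T [W [[e ei] WB WS]]] aB.
have [S] := lift _ (gBor_setC (WB e)).
rewrite -aB => /(gSigma_mono gkp)/WS[y <-] DE.
have [y' y'P] : exists y' : cantor_space k, (fun t => y' (e t)) = y.
  have [[t0 _]|nT] := pselect (exists t : T, True).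
    have [h eh] := embeds_leftinv t0 ei; exists (y \o h).
    by apply/funext => t /=; rewrite eh.
  by exists (fun=> true); apply/funext => t; case: nT; exists t.
by have /seteqP[/(_ y') + /(_ y')] := DE; rewrite /= y'P; tauto.
Qed.

End universal_sets.

(** * Borel embeddings of ^k 2 *)

Lemma weight_le_enum (X : topologicalType) : weight_le X k ->
  exists2 B : k -> set X, forall x, open (B x) &
    forall U : set X, open U -> exists D : set k, U = \bigcup_(x in D) B x.
Proof.
move=> [F [Fo Fb] /card_leP[h]].
pose e (U : F) : k := val (h U).
have ei : injective e.
  by move=> U V /val_inj/inj; rewrite !inE; apply.
have /choice[B BP] : forall x, exists S : set X,
    open S /\ forall U : F, e U = x -> S = val U.
  move=> x; have [[U Ux]|nU] := pselect (exists U : F, e U = x).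
    exists (val U); split=> [|V]; last by rewrite -Ux => /ei->.
    by apply: Fo; apply: set_mem; apply: valP.
  (* Indices that enumerate no member of the base carry the empty set. *)
  by exists set0; split=> [|U Ux]; [apply: open0|case: nU; exists U].
exists B => [x|U oU]; first by have [] := BP x.
exists [set x | B x `<=` U]; apply/seteqP; split=> [t Ut|t [x BU /BU]//].
have [|V [FV Vt] VU] := Fb t U; first exact: open_nbhs_nbhs.
pose v : F := exist _ V (mem_set FV).
have Bv : B (e v) = V by rewrite ((BP (e v)).2 v erefl).
by exists (e v); rewrite /= Bv.
Qed.

Lemma cone_enum : exists2 B : k -> set (cantor_space k), forall x, open (B x) &
  forall U : set (cantor_space k), open U ->
    exists D : set k, U = \bigcup_(x in D) B x.
Proof.
have /card_eqPle[/card_leTP[e ei] _] := k_two; have [x0 _] := k_inhabited.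
have [h eh] := embeds_leftinv (initial_part (fun=> true) x0) ei.
exists (fun x => cone (h x)) => [x|U oU]; first exact: cone_open.
exists [set x | cone (h x) `<=` U].
apply/seteqP; split=> [y Uy|y [x xU /xU]//].
by have [s sy sU] := open_cone oU Uy; exists (e s); rewrite /= eh.
Qed.

(** The traces of Borel sets contain the relatively open sets and are closed
    under complements and unions of length less than [kp]. *)
Lemma gBor_subspace (X : topologicalType) (A : set X) (V : set A) :
  gBor kp V -> exists2 S : set X, gBor kp S & V = set_val @^-1` S.
Proof.
pose tr := [set V : set A | exists2 S : set X, gBor kp S & V = set_val @^-1` S].
have : @gBor kp A `<=` tr; last by apply.
apply: smallest_sub => [|_ [S oS <-]]; last by exists S => //; apply: gBor_open.
split=> [_ [S BS ->]|d C dkp /= trC].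
  by exists (~` S) => //; apply: gBor_setC.
have /choice[S SP] : forall xi, exists S, gBor kp S /\ C xi = set_val @^-1` S.
  by move=> xi; have [S BS CS] := trC xi; exists S.
exists (\bigcup_xi S xi).
  by apply: (gBor_is_closed kp X).2 => // xi; have [] := SP xi.
rewrite preimage_bigcup; apply: eq_bigcupr => xi _; by have [] := SP xi.
Qed.

(** Measurability of the inverse gives this for open sets, through the subspace
    f[^k 2], and the sets that lift are closed under the Borel operations. *)
Lemma borel_embedding_lift (X : topologicalType) (f : cantor_space k -> X) :
  borel_embedding kp f -> forall D : set (cantor_space k), gBor kp D ->
    exists2 S : set X, gBor kp S & D = f @^-1` S.
Proof.
move=> [fi _ [h [fh _ hB]]].
pose tr := [set D : set (cantor_space k) |
  exists2 S : set X, gBor kp S & D = f @^-1` S].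
have : @gBor kp (cantor_space k) `<=` tr; last by move=> + D => /(_ D).
apply: smallest_sub => [|U /hB/gBor_subspace[S BS hS]].
  split=> [_ [S BS ->]|d C dkp /= trC].
    by exists (~` S) => //; apply: gBor_setC.
  have /choice[S SP] : forall xi, exists S, gBor kp S /\ C xi = f @^-1` S.
    by move=> xi; have [S BS CS] := trC xi; exists S.
  exists (\bigcup_xi S xi).
    by apply: (gBor_is_closed kp X).2 => // xi; have [] := SP xi.
  by rewrite preimage_bigcup; apply: eq_bigcupr => xi _; have [] := SP xi.
exists S => //; apply/seteqP.
have E y : U y = S (f y).
  by rewrite -[y in LHS]fh -[U _]/((h @^-1` U) (corestr f y)) hS.
by split=> y; rewrite /= E.
Qed.

Lemma embedding_not_collapses (X : topologicalType) (f : cantor_space k -> X) :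
  weight_le X k -> borel_embedding kp f -> ~ collapses k X.
Proof.
move=> /weight_le_enum[B Bo base] fe.
move=> /(collapses_starP X star_singular)/borel_order_ltP[a [_ akp]].
rewrite gBor_succ; apply: (diagonal base) akp => //; last by left.
  by have [_ fo _] := fe => x; apply: (fo (set_val @^-1` B x)); exists (B x).
exact: borel_embedding_lift.
Qed.

Lemma cantor_not_collapses : ~ collapses k (cantor_space k).
Proof.
have [B Bo base] := cone_enum.
move=> /(collapses_starP _ star_singular)/borel_order_ltP[a [_ akp]].
rewrite gBor_succ; apply: (@diagonal _ id B base) akp => //; last by left.
  by move=> x; apply: gBor_open; apply: Bo.
by move=> D BD; exists D.
Qed.

End successor_of_singular.

Theorem corollary5p3 (k kp : Ord) (k_sing : singular_cardinal k)
    (kp_succ : is_succ_cardinal k kp) (k_two : two_lt_eq k) :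
  [/\ forall X : topologicalType,
        [set: X] !=set0 -> @regular_space X -> hausdorff_space X ->
        weight_le X k ->
        (collapses k X <-> collapses kp X) /\
        (borel_order_lt k X kp <-> borel_order_lt kp X kp),
      ~ collapses k (cantor_space k) &
      forall X : topologicalType,
        [set: X] !=set0 -> @regular_space X -> hausdorff_space X ->
        weight_le X k ->
        (exists f : cantor_space k -> X, borel_embedding kp f) ->
        ~ collapses k X].
Proof.
split=> [X _ _ _ _||X _ _ _ wX [f fe]].
- by split; [exact: collapses_succ|exact: borel_order_lt_succ].
- exact: cantor_not_collapses k_sing kp_succ k_two.
- exact: embedding_not_collapses k_sing kp_succ k_two _ _ wX fe.
Qed.
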